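(* The algebraic multiplicity of the zero eigenvalue of a tensor is not invariant under the action $\mathcal A\mapsto P\cdot\mathcal A$ of the complex orthogonal group $\mathbb O(n,\mathbb C)$ on $\mathbb T(\mathbb C^n,m)$. That is, there exist $m\geq 2$, $n\geq 1$, a tensor $\mathcal A\in\mathbb T(\mathbb C^n,m)$ having $0$ as an eigenvalue, and a matrix $P\in\mathbb O(n,\mathbb C)$ such that the algebraic multiplicity of $0$ as an eigenvalue of $\mathcal A$ differs from the algebraic multiplicity of $0$ as an eigenvalue of $P\cdot\mathcal A$.
   Context: $\mathbb T(\mathbb C^n,m)=\otimes^m\mathbb C^n$ is the space of $m$-th order $n$-dimensional complex tensors $\mathcal A=(a_{i_1\ldots i_m})$. $\mathbb O(n,\mathbb C)=\{P\in\mathbb C^{n\times n}:PP^{\mathsf T}=I\}$. For $P=(p_{ij})\in\mathbb C^{n\times n}$, $P\cdot\mathcal A\in\mathbb T(\mathbb C^n,m)$ is defined by $$(P\cdot\mathcal A)_{i_1\dots i_m}=\sum_{j_1,\dots,j_m=1}^n a_{j_1\dots j_m}p_{i_1j_1}\cdots p_{i_mj_m}.$$ For $\mathbf x\in\mathbb C^n$, $\mathcal A\mathbf x^{m-1}\in\mathbb C^n$ has $i$-th entry $\sum_{i_2,\dots,i_m=1}^n a_{ii_2\ldots i_m}x_{i_2}\cdots x_{i_m}$, and $\mathbf x^{[m-1]}$ has $i$-th entry $x_i^{m-1}$. The identity tensor $\mathcal I$ has entries $1$ when $i_1=\dots=i_m$ and $0$ otherwise. A number $\lambda\in\mathbb C$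 is an eigenvalue of $\mathcal A$ if there is $\mathbf x\neq\mathbf 0$ with $\mathcal A\mathbf x^{m-1}=\lambda\mathbf x^{[m-1]}$. The determinant $\operatorname{Det}(\mathcal A)$ is the classical resultant of the $n$ homogeneous polynomials $(\mathcal A\mathbf x^{m-1})_i$, $i=1,\dots,n$, of degree $m-1$ in $n$ variables (the irreducible integer polynomial in the coefficients vanishing if and only if the system has a nontrivial common zero in $\mathbb C^n$, normalized to be $1$ at $(x_1^{m-1},\dots,x_n^{m-1})$). The characteristic polynomial is $\chi(\lambda)=\operatorname{Det}(\lambda\mathcal I-\mathcal A)$, whose roots are exactly the eigenvalues of $\mathcal A$. The algebraic multiplicity of an eigenvalue is its multiplicity as a root of $\chi$. *)

(* Defs.v *)
From Stdlib Require Import ClassicalEpsilon.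
From HB Require Import structures.
From mathcomp Require Import all_boot all_order all_algebra.
From mathcomp Require Import complex.
From mathcomp Require Import reals.
From mathcomp Require Import mpoly.

Set Implicit Arguments.
Unset Strict Implicit.
Unset Printing Implicit Defensive.

Import GRing.Theory.
Local Open Scope ring_scope.

Section Tensor.

Variable K : comNzRingType.

Definition tensor (n m : nat) := {ffun m.-tuple 'I_n -> K}.

Definition idtensor n m : tensor n m :=
  [ffun t : m.-tuple 'I_n => (constant t)%:R].

Definition tensor_act n m (P : 'M[K]_n) (A : tensor n m) : tensor n m :=
  [ffun t : m.-tuple 'I_n =>
     \sum_(s : m.-tuple 'I_n) A s * \prod_(k < m) P (tnth t k) (tnth s k)].

(* A x^{m-1}: the index tuples (i_1, ..., i_m) of the i-th entry are those with
   i_1 = i.  Writing them with ohead/behead avoids a cast from m.-1.+1 to m;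
   the value is only meaningful for 0 < m. *)
Definition tensor_apply n m (A : tensor n m) (x : 'cV[K]_n) : 'cV[K]_n :=
  \col_i \sum_(t : m.-tuple 'I_n | ohead t == Some i)
            A t * \prod_(j <- behead t) x j 0.

Definition eigenvalue_tensor n m (A : tensor n m) (lambda : K) : Prop :=
  exists2 x : 'cV[K]_n, x != 0 &
    tensor_apply A x = \col_i (lambda * x i 0 ^+ m.-1).

End Tensor.

(* The n forms (A x^{m-1})_i, obtained by evaluating A at the column of
   indeterminates. *)
Definition tensor_forms (K : comNzRingType) n m (A : tensor K n m)
    (i : 'I_n) : {mpoly K[n]} :=
  tensor_apply [ffun t => (A t)%:MP : {mpoly K[n]}] (\col_j 'X_j) i 0.

Definition orthogonal_mx (K : comNzRingType) n (P : 'M[K]_n) : Prop :=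
  P *m P^T = 1%:M.

(* One index for each coefficient of a system of n forms of degree d in n
   variables: the number of the form, and a monomial of degree d. *)
Definition coef_index (n d : nat) : finType :=
  ('I_n * {mon : 'X_{1..n < d.+1} | mdeg mon == d})%type.

(* Integer polynomials in these coefficients. *)
Definition coef_poly (n d : nat) := {mpoly int[#|coef_index n d|]}.

Definition coef_eval (n d : nat) (Q : coef_poly n d) (K : comNzRingType)
    (f : 'I_n -> {mpoly K[n]}) : K :=
  (map_mpoly intr Q).@[fun k : 'I_#|coef_index n d| =>
     let u : coef_index n d := enum_val k in (f u.1)@_(bmnm (val u.2))].

Definition irreducible_elt (D : idomainType) (q : D) : Prop :=
  [/\ q != 0, q \isn't a GRing.unit &
      forall a b : D, q = a * b -> a \is a GRing.unit \/ b \is a GRing.unit].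

Definition is_resultant (R : realType) (n d : nat) (Q : coef_poly n d) : Prop :=
  [/\ irreducible_elt Q,
      (forall f : 'I_n -> {mpoly R[i][n]},
         (forall i, f i \is d.-homog) ->
         (coef_eval Q f = 0 <->
          exists2 x : 'cV[R[i]]_n, x != 0 &
            forall i, (f i).@[fun j => x j 0] = 0))
    & coef_eval Q (fun i : 'I_n => 'X_i ^+ d : {mpoly R[i][n]}) = 1].

(* For 0 < n and 0 < d there is exactly one polynomial satisfying is_resultant:
   this is the classical existence theorem for resultants, and two irreducible
   integer polynomials with the same complex zero locus agree up to sign. *)
Definition resultant (R : realType) (n d : nat) : coef_poly n d :=
  epsilon (inhabits (0 : coef_poly n d)) (@is_resultant R n d).

(* The entries of the tensor may lie in any commutative ring K, since the
   resultant has integer coefficients; charpoly_tensor uses K = {poly R[i]}. *)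
Definition Det (R : realType) (K : comNzRingType) n m (A : tensor K n m) : K :=
  coef_eval (resultant R n m.-1) (tensor_forms A).

Definition charpoly_tensor (R : realType) n m (A : tensor R[i] n m) :
    {poly R[i]} :=
  Det R [ffun t => 'X * idtensor {poly R[i]} n m t - (A t)%:P].

Definition alg_mult (R : realType) n m (A : tensor R[i] n m) (lambda : R[i]) :
    nat :=
  mup lambda (charpoly_tensor A).

(* Main.v *)
(* Let Q be any polynomial with the defining properties of the resultant.
   Scaling a system of forms does not change its zeros, which forces Q to be
   homogeneous, of degree D say.  Hence every characteristic polynomial has
   degree D, and the multiplicity of the eigenvalue 0 is D when 0 is the only
   eigenvalue, and smaller than D otherwise.  So it is enough to rotate a tensor
   whose only eigenvalue is 0 into one with a nonzero eigenvalue: the forms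
   (0, x^2) rotated by 45 degrees have the eigenvector (1, -1).

   As the resultant is given by a choice operator, one must also exhibit one
   for two binary quadratic forms: Sylvester's
     (a0 b2 - a2 b0)^2 - (a0 b1 - a1 b0) (a1 b2 - a2 b1).
   It is irreducible because substituting (t, 0, 1) and (1, 1, t) for the
   coefficients turns it into t^4 + t + 1, irreducible of the same degree
   over F_2. *)

From Stdlib Require Import ClassicalEpsilon.
From mathcomp Require Import all_boot all_order all_algebra.
From mathcomp Require Import complex reals mpoly.
From mathcomp Require Import zify ring.
Require Import Defs.

Set Implicit Arguments.
Unset Strict Implicit.
Unset Printing Implicit Defensive.

Import Order.TTheory GRing.Theory Num.Theory.
Local Open Scope ring_scope.

(** * Evaluation of integer polynomials, in particular along lines *)

Section IntegerEvaluation.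

Variable n : nat.

Lemma map_mpoly_intr_meval (K : comNzRingType) (v : 'I_n -> K)
    (Q : {mpoly int[n]}) :
  (map_mpoly intr Q).@[v] =
  \sum_(m <- msupp Q) (Q@_m)%:~R * \prod_i v i ^+ m i.
Proof.
rewrite /map_mpoly /mmap raddf_sum /=; apply: eq_bigr => m _.
by rewrite mevalM mevalC mmap1_id mevalX.
Qed.

Lemma rmorph_meval_intr (K L : comNzRingType) (phi : {rmorphism K -> L})
    (v : 'I_n -> K) (Q : {mpoly int[n]}) :
  phi (map_mpoly intr Q).@[v] = (map_mpoly intr Q).@[phi \o v].
Proof.
rewrite !map_mpoly_intr_meval rmorph_sum; apply: eq_bigr => m _ /=.
rewrite rmorphM rmorph_int rmorph_prod; congr (_ * _).
by apply: eq_bigr => i _; rewrite rmorphXn.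
Qed.

(** The relation [S p k c], a degree bound [k] together with the coefficient at [k], is
    multiplicative. Since [c] may vanish, no cancellation has to be excluded and any commutative
    ring will do. *)
Lemma size_prod_linear (K : comNzRingType) (v : 'I_n -> {poly K})
    (m : 'X_{1..n}) :
    (forall i, (size (v i) <= 2)%N) ->
  (size (\prod_i v i ^+ m i)%R <= (mdeg m).+1)%N /\
  (\prod_i v i ^+ m i)`_(mdeg m) = \prod_i (v i)`_1 ^+ m i.
Proof.
move=> szv; rewrite mdegE.
pose S (p : {poly K}) (k : nat) (c : K) := (size p <= k.+1)%N /\ p`_k = c.
have SM p k c q l e : S p k c -> S q l e -> S (p * q) (k + l)%N (c * e).
  move=> [szp pk] [szq ql]; split.
    apply: leq_trans (size_polyMleq _ _) _.
    rewrite -ltnS; apply: leq_trans (leqSpred _) _.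
    case: (size p + size q)%N (leq_add szp szq) => [|s] //=.
    by rewrite addSn addnS.
  rewrite coefM (bigD1 (Ordinal (leq_addr l k : k < (k + l).+1)%N)) //=.
  rewrite pk addKn ql big1 ?addr0 // => i; rewrite -val_eqE /= => ik.
  case: (ltngtP i k) ik => // [ik|ki] _; last by rewrite nth_default ?mul0r //;
      exact: leq_trans szp ki.
  rewrite [q`__]nth_default ?mulr0 //; apply: leq_trans szq _.
  by rewrite ltn_subRL ltn_add2r.
have SX p c k : S p 1%N c -> S (p ^+ k) k (c ^+ k).
  move=> Sp; elim: k => [|k IHk]; first by split; rewrite ?size_poly1 ?coef1.
  by rewrite !exprS; have := SM _ _ _ _ _ _ Sp IHk.
suff : S (\prod_i v i ^+ m i) (\sum_i m i)%N (\prod_i (v i)`_1 ^+ m i) by [].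
apply: (big_ind3 S).
- by split; rewrite ?size_poly1 ?coef1.
- by move=> p k c q l e; exact: SM.
- by move=> i _; apply: SX; split.
Qed.

Lemma size_meval_linear (K : comNzRingType) (v : 'I_n -> {poly K})
    (Q : {mpoly int[n]}) :
    (forall i, (size (v i) <= 2)%N) ->
  (size (map_mpoly intr Q).@[v]%R <= msize Q)%N.
Proof.
move=> szv; rewrite map_mpoly_intr_meval big_seq.
apply: (big_ind (fun p : {poly K} => (size p <= msize Q)%N)).
- by rewrite size_poly0.
- by move=> p q szp szq; rewrite (leq_trans (size_polyD _ _)) // geq_max szp.
move=> m mQ; rewrite -(rmorph_int polyC) mul_polyC.
apply: leq_trans (size_scale_leq _ _) _.
exact: leq_trans (size_prod_linear _ szv).1 (msize_mdeg_lt mQ).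
Qed.

(** Along an affine line, the top coefficient of a form of degree [d] is its value at the direction
    of the line. *)
Lemma coef_meval_linear (K : comNzRingType) (v : 'I_n -> {poly K}) d
    (Q : {mpoly int[n]}) :
    (forall i, (size (v i) <= 2)%N) -> Q \is d.-homog ->
  (map_mpoly intr Q).@[v]`_d = (map_mpoly intr Q).@[fun i => (v i)`_1].
Proof.
move=> szv homQ; rewrite !map_mpoly_intr_meval coef_sum big_seq [RHS]big_seq.
apply: eq_bigr => m mQ; rewrite -[d](dhomog_mf homQ mQ).
rewrite -(rmorph_int polyC) mul_polyC coefZ.
by rewrite (size_prod_linear _ szv).2.
Qed.

(** Along a line through 0, the homogeneous components of [Q] are separated by the powers of
    ['X]. *)
Lemma coef_meval_ray (K : comNzRingType) (c : 'I_n -> K) d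
    (Q : {mpoly int[n]}) :
  (map_mpoly intr Q).@[fun i => c i *: 'X]`_d =
  (map_mpoly intr (pihomog mdeg d Q)).@[c].
Proof.
rewrite [in LHS]map_mpoly_intr_meval coef_sum pihomogE.
rewrite (rmorph_sum (map_mpoly intr)) (rmorph_sum (meval c)).
rewrite [RHS]big_mkcond /=; apply: eq_bigr => m _.
rewrite -(rmorph_int polyC) mul_polyC coefZ.
under eq_bigr do rewrite exprZn.
rewrite scaler_prod prodrXr -mdegE coefZ coefXn eq_sym.
have [_|_] := eqVneq; last by rewrite !mulr0.
by rewrite map_mpolyZ map_mpolyX mevalZ mevalX mulr1.
Qed.

End IntegerEvaluation.

(** * Integer points off a hypersurface, and polynomials whose only root is 0 *)

Lemma int_poly_nonroot (p : {poly int}) : p != 0 -> exists x, p.[x] != 0.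
Proof.
move=> p0; pose s : seq int := [seq (Posz i) | i <- iota 0 (size p)].
have us : uniq s by rewrite map_inj_uniq ?iota_uniq // => i j [].
have [all_s|/allPn[x _ xs]] := boolP (all (root p) s); last by exists x.
by have := max_poly_roots p0 all_s us; rewrite size_map size_iota ltnn.
Qed.

(** Induction on the number of variables: view [p] as a polynomial in the last variable, choose the
    other coordinates so that one of its coefficients survives, then choose the last coordinate. *)
Lemma int_mpoly_nonroot n (p : {mpoly int[n]}) :
  p != 0 -> exists v, p.@[v] != 0.
Proof.
elim: n p => [|n IHn] p p0.
  exists (fun => 0); apply: contra p0; rewrite mevalE => p0.
  apply/eqP/mpolyP => m; rewrite mcoeff0.
  have [mp|] := boolP (m \in msupp p); last by move/memN_msupp_eq0.
  move: p0; rewrite (bigD1_seq m) //= big_ord0 mulr1 big1 => [|m' m'm].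
    by rewrite addr0 => /eqP.
  by case/eqP: m'm; apply/mnmP; case.
(* [low] forgets the last exponent. The leading monomial [m0] singles out a coefficient of [muni p]
   that is nonzero because it contains [p@_m0]. *)
pose low (m : 'X_{1..n.+1}) := [multinom m (widen_ord (leqnSn n) i) | i < n].
have m0p := mlead_supp p0; set m0 := mlead p in m0p.
have muni_coef : (muni p)`_(m0 ord_max)@_(low m0) = p@_m0.
  rewrite muniE coef_sum raddf_sum /= (bigD1_seq m0) //= big1 => [|m mm0].
    by rewrite addr0 coefZ coefXn eqxx mulr1 mcoeffZ mcoeffX eqxx mulr1.
  rewrite coefZ coefXn; have [mm|_] := eqVneq; last by rewrite mulr0 mcoeff0.
  rewrite mulr1 mcoeffZ mcoeffX; have [lowm|_] := eqVneq; last by rewrite mulr0.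
  case/eqP: mm0; apply/mnmP => i; have [j ->|->] := unliftP ord_max i => //.
  have -> : lift ord_max j = widen_ord (leqnSn n) j by apply: val_inj;
      rewrite /= /bump leqNgt ltn_ord.
  by move/mnmP/(_ j): lowm; rewrite !mnmE.
have cm0 : (muni p)`_(m0 ord_max) != 0.
  by apply: contraTneq m0p => c0;
      rewrite mcoeff_msupp -muni_coef c0 mcoeff0 eqxx.
have [v v0] := IHn _ cm0.
have : map_poly (meval v) (muni p) != 0.
  apply: contra v0 => /eqP/polyP/(_ (m0 ord_max)).
  by rewrite coef_map coef0 => ->.
case/int_poly_nonroot => x px.
exists (fun i => if unlift ord_max i is Some j then v j else x).
apply: contra px => /eqP px; apply/eqP; rewrite -{}px muniE mevalE.
rewrite rmorph_sum horner_sum; apply: eq_bigr => m _.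
rewrite -[_ *: 'X^_]mul_polyC rmorphM /= map_polyC map_polyXn /= hornerM
    hornerC.
rewrite hornerXn mevalZ mevalX -mulrA; congr (_ * _).
rewrite big_ord_recr /= unlift_none; congr (_ * _); apply: eq_bigr => i _.
have -> : widen_ord (leqnSn n) i = lift ord_max i.
  by apply: val_inj; rewrite /= /bump leqNgt ltn_ord.
rewrite liftK mnmE; congr (_ ^+ m _).
by apply: val_inj; rewrite /= /bump leqNgt ltn_ord.
Qed.
(** The polynomial splits into linear factors, each of which must be ['X]. *)
Lemma closed_field_monomial (F : closedFieldType) (p : {poly F}) :
  (forall x, root p x -> x = 0) -> p = lead_coef p *: 'X^((size p).-1).
Proof.
move=> rp0; have [->|p0] := eqVneq p 0; first by rewrite lead_coef0 scale0r.
have [r pr] := closed_field_poly_normal p.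
have r0 z : z \in r -> z = 0.
  by move=> zr; apply: rp0; rewrite pr rootZ ?lead_coef_eq0 // root_prod_XsubC.
have {r0}prX : \prod_(z <- r) ('X - z%:P) = 'X^(size r) :> {poly F}.
  elim: r r0 {pr} => [|z r IHr] r0; first by rewrite big_nil.
  rewrite big_cons IHr => [|y yr]; last by apply: r0; rewrite inE yr orbT.
  by rewrite (r0 z) ?mem_head // subr0 exprS.
have -> : (size p).-1 = size r.
  have := congr1 (fun q : {poly F} => size q) pr.
  by rewrite prX size_scale ?lead_coef_eq0 // size_polyXn => ->.
by rewrite -prX.
Qed.

(** * Systems of forms and their coefficient vectors *)

Section CoefVectors.

Variables (n d : nat) (K : comNzRingType).

Definition coef_vector (f : 'I_n -> {mpoly K[n]}) : 'I_#|coef_index n d| -> K :=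
  fun k => let u : coef_index n d := enum_val k in (f u.1)@_(bmnm (val u.2)).

(** A right inverse of [coef_vector]: every point of the coefficient space comes from a system of
    forms, so the zero criterion of [is_resultant] applies at every point. *)
Definition forms_of (c : 'I_#|coef_index n d| -> K) (i : 'I_n) :
    {mpoly K[n]} :=
  \sum_(u : {mon : 'X_{1..n < d.+1} | mdeg mon == d})
     c (enum_rank ((i, u) : coef_index n d)) *: 'X_[bmnm (val u)].

Lemma coef_evalE (Q : coef_poly n d) (f : 'I_n -> {mpoly K[n]}) :
  coef_eval Q f = (map_mpoly intr Q).@[coef_vector f].
Proof. by []. Qed.

Lemma forms_of_homog c i : forms_of c i \is d.-homog.
Proof.
apply: rpred_sum => u _; apply: rpredZ; rewrite dhomogX; exact: (valP u).
Qed.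

Lemma forms_ofK c : coef_vector (forms_of c) =1 c.
Proof.
move=> k; rewrite /coef_vector /forms_of.
case E: (enum_val k) => [i u] /=;
    rewrite raddf_sum (bigD1 u) //= big1 => [|u' u'u].
  by rewrite mcoeffZ mcoeffX eqxx mulr1 addr0 -E enum_valK.
by rewrite mcoeffZ mcoeffX !val_eqE (negbTE u'u) mulr0.
Qed.

Lemma coef_eval_forms_of (Q : coef_poly n d) c :
  coef_eval Q (forms_of c) = (map_mpoly intr Q).@[c].
Proof. by rewrite coef_evalE; apply: meval_eq; exact: forms_ofK. Qed.

End CoefVectors.

(** * Homogeneity of resultants *)

Section ResultantHomogeneous.

Variables (R : realType) (n d : nat) (Q : coef_poly n d).
Hypothesis resQ : is_resultant R Q.

Let zeroQ := let: And3 _ h _ := resQ in h.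

Lemma resultant_eval_scale (c : 'I_#|coef_index n d| -> R[i]) t : t != 0 ->
  (map_mpoly intr Q).@[fun k => t * c k] = 0 -> (map_mpoly intr Q).@[c] = 0.
Proof.
move=> t0; rewrite -!coef_eval_forms_of => /zeroQ[|x x0 fx0].
  by move=> i; exact: forms_of_homog.
apply/zeroQ; first by move=> i; exact: forms_of_homog.
exists x => // i; apply: (mulfI t0); rewrite mulr0 -[RHS](fx0 i) -mevalZ.
congr (_.@[_]); rewrite scaler_sumr; apply: eq_bigr => u _.
by rewrite scalerA.
Qed.

(* At a point where [Q] and two of its homogeneous components do not vanish,
   the restriction of [Q] to the line through 0 vanishes at most at 0, because
   scaling a system of forms does not change its zeros; so that restriction is
   a monomial, and the two degrees coincide. *)
Lemma resultant_homog : Q \is (mdeg (mlead Q)).-homog.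
Proof.
have Q0 : Q != 0 by case: resQ => -[].
have pi0 m : m \in msupp Q -> pihomog mdeg (mdeg m) Q != 0.
  move=> mQ; apply: contraTneq (mQ) => /(congr1 (mcoeff m)).
  rewrite mcoeff_msupp negbK mcoeff0 pihomogE raddf_sum big_mkcond /=.
  rewrite (bigD1_seq m) //= eqxx mcoeffZ mcoeffX eqxx mulr1 big1 ?addr0 =>
      [->|m' m'm] //.
  by case: ifP => // _; rewrite mcoeffZ mcoeffX (negbTE m'm) mulr0.
apply/dhomogP => m mQ; set D := mdeg _.
(* Multiplying the three polynomials gives one integer point at which none of them vanishes. *)
have := mulf_neq0 Q0 (mulf_neq0 (pi0 _ mQ) (pi0 _ (mlead_supp Q0))).
case/int_mpoly_nonroot => v; rewrite !mevalM !mulf_eq0 !negb_or.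
case/and3P => Qv Qmv QDv.
pose c i : R[i] := (v i)%:~R.
have Ec (q : coef_poly n d) : q.@[v] != 0 -> (map_mpoly intr q).@[c] != 0.
  move=> qv; rewrite -[c]/(intr \o v) -rmorph_meval_intr intr_eq0.
  congr (~~ (_.@[_] == 0)): qv; apply/mpolyP => m'.
  by rewrite mcoeff_map_mpoly /= intz.
pose p : {poly R[i]} := (map_mpoly intr Q).@[fun i => c i *: 'X].
have /closed_field_monomial pX : forall x, root p x -> x = 0.
  move=> x; apply: contraTeq => x0; apply: contra (Ec _ Qv).
  rewrite /root /p -horner_evalE rmorph_meval_intr => px.
  apply/eqP/(resultant_eval_scale x0); rewrite -[RHS](eqP px).
  by apply: meval_eq => i; rewrite /= horner_evalE hornerZ hornerX mulrC.
have degp k : p`_k != 0 -> k = (size p).-1.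
  rewrite {1}pX coefZ coefXn; have [//|_] := eqVneq k.
  by rewrite mulr0 eqxx.
have degQ k : (pihomog mdeg k Q).@[v] != 0 -> k = (size p).-1.
  by move=> Qkv; apply: degp; rewrite coef_meval_ray Ec.
exact: etrans (degQ _ Qmv) (esym (degQ _ QDv)).
Qed.

End ResultantHomogeneous.

(** * The forms of a tensor and of the pencil of its characteristic polynomial *)

Section TensorForms.

Variables (n d : nat).

Lemma mcoeff_tensor_forms (K : comNzRingType) (A : tensor K n d.+1) i mm :
  (tensor_forms A i)@_mm =
  \sum_(t : d.+1.-tuple 'I_n | ohead t == Some i)
     A t * ((\sum_(j <- behead t) U_(j))%MM == mm)%:R.
Proof.
rewrite /tensor_forms mxE raddf_sum; apply: eq_bigr => t _ /=.
rewrite ffunE mcoeffCM -mcoeffX; congr (_ * _@_mm).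
by rewrite -mprodXE; apply: eq_bigr => j _; rewrite mxE.
Qed.

Lemma coef_vector_tensor_forms (K : comNzRingType) (A : tensor K n d.+1)
    (k : 'I_#|coef_index n d|) (u := enum_val k : coef_index n d) :
  coef_vector (tensor_forms A) k =
  \sum_(t : d.+1.-tuple 'I_n | ohead t == Some u.1)
     A t * ((\sum_(j <- behead t) U_(j))%MM == bmnm (val u.2))%:R.
Proof. exact: mcoeff_tensor_forms. Qed.

(** The pencil is an affine line in the coefficient space, with the identity system as direction, so
    the lemmas on evaluation along lines apply to it. *)
Lemma coef_vector_char (K : comNzRingType) (A : tensor K n d.+1)
    (k : 'I_#|coef_index n d|) :
  coef_vector (tensor_forms
    [ffun t => 'X * idtensor {poly K} n d.+1 t - (A t)%:P]) k =
  coef_vector (tensor_forms (idtensor K n d.+1)) k *: 'X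
  - (coef_vector (tensor_forms A) k)%:P.
Proof.
rewrite !coef_vector_tensor_forms.
rewrite scaler_suml rmorph_sum -sumrB; apply: eq_bigr => t _.
rewrite !ffunE -mul_polyC !rmorphM !rmorph_nat.
ring.
Qed.

Lemma coef_vector_shift (K : comNzRingType) (A : tensor K n d.+1) x
    (k : 'I_#|coef_index n d|) :
  coef_vector (tensor_forms
    [ffun t => x * idtensor K n d.+1 t - A t]) k =
  x * coef_vector (tensor_forms (idtensor K n d.+1)) k
  - coef_vector (tensor_forms A) k.
Proof.
rewrite !coef_vector_tensor_forms mulr_sumr -sumrB; apply: eq_bigr => t _.
by rewrite !ffunE; ring.
Qed.

Lemma tensor_apply_shift (K : comNzRingType) (A : tensor K n d.+1) x
    (y : 'cV[K]_n) i :
  tensor_apply [ffun t => x * idtensor K n d.+1 t - A t] y i 0 =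
  x * tensor_apply (idtensor K n d.+1) y i 0 - tensor_apply A y i 0.
Proof.
rewrite !mxE mulr_sumr -sumrB.
by apply: eq_bigr => t _; rewrite !ffunE; ring.
Qed.

Lemma tensor_forms_homog (K : comNzRingType) (A : tensor K n d.+1) i :
  tensor_forms A i \is d.-homog.
Proof.
apply/dhomogP => mm; rewrite mcoeff_msupp mcoeff_tensor_forms.
apply: contraNeq => mmd; rewrite big1 // => t _.
have [Et|_] := eqVneq; last by rewrite mulr0.
case/eqP: mmd; rewrite /= -Et mdeg_sum.
under eq_bigr do rewrite mdeg1.
by rewrite sum1_size size_behead size_tuple.
Qed.

Lemma tensor_forms_meval (K : comNzRingType) (A : tensor K n d.+1) (x :
    'cV[K]_n) i :
  (tensor_forms A i).@[fun j => x j 0] = tensor_apply A x i 0.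
Proof.
rewrite /tensor_forms !mxE raddf_sum; apply: eq_bigr => t _ /=.
rewrite ffunE mevalM mevalC rmorph_prod; congr (_ * _).
by apply: eq_bigr => j _; rewrite mxE; exact: mevalXU.
Qed.

Lemma tensor_forms_id (K : comNzRingType) i :
  tensor_forms (idtensor K n d.+1) i = 'X_i ^+ d.
Proof.
rewrite /tensor_forms mxE (bigD1 [tuple of nseq d.+1 i]) //= [X in _ + X]big1
    => [|t].
  rewrite !ffunE (_ : constant _ = true) ?mpolyC1 ?mul1r ?addr0;
      last exact: (constant_nseq d.+1 i).
  under eq_bigr do rewrite mxE.
  by rewrite big_nseq -Monoid.iteropE.
case/andP => /eqP ti; rewrite -val_eqE /= !ffunE => tn.
have [/(constantP i)[k tk]|_] := boolP (constant t);
    last by rewrite mpolyC0 mul0r.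
move: tk ti tn; rewrite size_tuple => -> /= [->].
by rewrite eqxx.
Qed.

Lemma tensor_apply_id (K : comNzRingType) (x : 'cV[K]_n) i :
  tensor_apply (idtensor K n d.+1) x i 0 = x i 0 ^+ d.
Proof. by rewrite -tensor_forms_meval tensor_forms_id rmorphXn /= mevalXU. Qed.

Variable Q : coef_poly n d.

Lemma horner_char_eval (K : comNzRingType) (A : tensor K n d.+1) x :
  (coef_eval Q (tensor_forms
    [ffun t => 'X * idtensor {poly K} n d.+1 t - (A t)%:P])).[x] =
  coef_eval Q (tensor_forms [ffun t => x * idtensor K n d.+1 t - A t]).
Proof.
rewrite -horner_evalE !coef_evalE rmorph_meval_intr.
apply: meval_eq => k; rewrite /= coef_vector_char.
by rewrite coef_vector_shift horner_evalE !hornerE mulrC.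
Qed.

(** Homogeneity bounds the degree by [e], and the coefficient at [e] is the value of [Q] at the
    direction of the pencil, the system of the ['X_i ^+ d], which is 1 by normalization. *)
Lemma size_char_eval (K : comNzRingType) (A : tensor K n d.+1) e :
    Q \is e.-homog -> coef_eval Q (fun i => 'X_i ^+ d : {mpoly K[n]}) = 1 ->
  size (coef_eval Q (tensor_forms
    [ffun t => 'X * idtensor {poly K} n d.+1 t - (A t)%:P])) = e.+1.
Proof.
move=> homQ Q1; rewrite coef_evalE; set v := coef_vector _.
have Q0 : Q != 0.
  apply: contra_eq_neq Q1 => ->.
  by rewrite /coef_eval raddf0 meval0 eq_sym oner_neq0.
have szv k : (size (v k) <= 2)%N.
  rewrite /v coef_vector_char (leq_trans (size_polyD _ _)) //
      geq_max size_polyN.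
  rewrite (leq_trans (size_scale_leq _ _)) ?size_polyX //=.
  by rewrite (leq_trans (size_polyC_leq1 _)).
apply/eqP; rewrite eqn_leq; apply/andP; split.
  rewrite -(dhomog_mf homQ (mlead_supp Q0)) /= mlead_deg //.
  exact: size_meval_linear.
rewrite ltnNge; apply: contraTN (oner_neq0 K) => /leq_sizeP/(_ _ (leqnn _)).
rewrite (coef_meval_linear szv homQ) negbK => Qe.
rewrite -[X in X == _]Q1 -[X in _ == X]Qe coef_evalE; apply/eqP/meval_eq => k.
rewrite /v coef_vector_char coefB coefZ coefX coefC mulr1 subr0.
by rewrite /coef_vector tensor_forms_id.
Qed.

End TensorForms.

(** * Roots and degree of the characteristic polynomial *)

Definition resultant_degree (R : realType) n d : nat :=
  mdeg (mlead (resultant R n d)).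

Section CharacteristicPolynomial.

Variables (R : realType) (n d : nat).
Hypothesis resE : exists Q : coef_poly n d, is_resultant R Q.
Implicit Type A : tensor R[i] n d.+1.

(** The choice operator is only known to return a resultant once one exists, hence the hypothesis
    [resE]; [quad_resultantP] provides it for two binary quadratic forms. *)
Lemma resultantP : is_resultant R (resultant R n d).
Proof. exact: (epsilon_spec (inhabits 0)). Qed.

(** Substituting [x] commutes with evaluating the resultant, so a root [x] means that the forms of x
    I - A have a common nontrivial zero. *)
Lemma root_charpoly_tensor A x :
  root (charpoly_tensor A) x <-> eigenvalue_tensor A x.
Proof.
have [_ zeroQ _] := resultantP.
pose B : tensor R[i] n d.+1 := [ffun t => x * idtensor R[i] n d.+1 t - A t].
have -> : root (charpoly_tensor A) x =
    (coef_eval (resultant R n d) (tensor_forms B) == 0).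
  by congr (_ == _); exact: horner_char_eval.
have applyB y i : tensor_apply B y i 0 = x * y i 0 ^+ d - tensor_apply A y i 0.
  by rewrite tensor_apply_shift tensor_apply_id.
have homB i : tensor_forms B i \is d.-homog by exact: tensor_forms_homog.
split=> [/eqP/(zeroQ _ homB)[y y0 By]|[y y0 Ay]].
  exists y => //; apply/colP => i; rewrite [RHS]mxE; apply/eqP.
  by rewrite eq_sym -subr_eq0 -applyB -tensor_forms_meval By.
apply/eqP/(zeroQ _ homB); exists y => // i.
by rewrite tensor_forms_meval applyB Ay mxE subrr.
Qed.

Lemma size_charpoly_tensor A : size (charpoly_tensor A) = (resultant_degree R n
    d).+1.
Proof.
have [_ _ QI] := resultantP.
exact: size_char_eval (resultant_homog resultantP) QI.
Qed.

Lemma alg_mult_nilpotent A :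
  (forall x, eigenvalue_tensor A x -> x = 0) -> alg_mult A 0 = resultant_degree
      R n d.
Proof.
move=> A0; rewrite /alg_mult; have szA := size_charpoly_tensor A.
have /closed_field_monomial -> : forall x, root (charpoly_tensor A) x -> x = 0.
  by move=> x /root_charpoly_tensor/A0.
rewrite szA /= -mul_polyC mupMr; last first.
  by rewrite rootC lead_coef_eq0 -size_poly_eq0 szA.
by rewrite -['X]subr0 mup_XsubCX eqxx.
Qed.

(** Otherwise a power of ['X] of the same degree would divide the characteristic polynomial, and 0
    would be its only root. *)
Lemma alg_mult_eigenvalue A x :
  x != 0 -> eigenvalue_tensor A x -> (alg_mult A 0%R < resultant_degree R n
      d)%N.
Proof.
move=> x0 /root_charpoly_tensor rx; have szA := size_charpoly_tensor A.
have A0 : charpoly_tensor A != 0 by rewrite -size_poly_eq0 szA.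
rewrite /alg_mult mup_ltn // subr0; apply: contra x0 => XA.
have := dvdp_size_eqp XA; rewrite szA size_polyXn eqxx => /esym/eqp_root XAr.
have : root ('X^(resultant_degree R n d)) x by rewrite XAr.
by rewrite /root hornerXn expf_eq0 => /andP[].
Qed.

End CharacteristicPolynomial.

(** * An irreducibility criterion for integer polynomials *)

(** Substituting polynomials of degree at most 1 never raises degrees. As the degree of [Q] is
    preserved, so is that of each factor, and irreducibility of the image makes one factor constant.
    That constant divides [Q.@[c] = 1], hence is a unit. *)
Lemma irreducible_of_linear_specialization (F : fieldType) n
    (Q : {mpoly int[n]}) (v : 'I_n -> {poly F}) (c : 'I_n -> int) :
    (forall i, (size (v i) <= 2)%N) -> irreducible_poly (map_mpoly intr Q).@[v]
        ->
    (msize Q <= size (map_mpoly intr Q).@[v]%R)%N -> Q.@[c] = 1 ->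
  irreducible_elt Q.
Proof.
move=> szv [szQ irrQ] msQ Qc.
have Q0 : Q != 0 by apply: contra_eq_neq Qc => ->; rewrite meval0.
have unitC (a b : {mpoly int[n]}) : Q = a * b -> (msize a <= 1)%N ->
    a \is a GRing.unit.
  move=> Qab /msize1_polyC aC; rewrite aC; apply: rmorph_unit.
  apply/unitrPr; exists b.@[c].
  by rewrite -Qc Qab mevalM [X in X.@[c] * _]aC mevalC.
split=> //.
  apply/negP => /unitrPr[b Qb]; have b0 : b != 0.
    by apply: contra_eq_neq Qb => ->; rewrite mulr0 eq_sym oner_neq0.
  have := msizeM Q0 b0; rewrite Qb msize1 => /esym.
  have := leq_trans szQ (size_meval_linear Q szv).
  case: (msize Q) => [|[|s]] //= _; move: b0; rewrite -msize_poly_eq0.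
  by case: (msize b) => // k _; rewrite addnS.
(* Here [k], [l] are the sizes of the factors and [s], [t] those of their images; the inequalities
   force [s = k] and [t = l]. *)
have arith (k l s t : nat) : (0 < s -> 0 < t -> s <= k -> t <= l ->
    (k + l).-1 <= (s + t).-1 -> (s == 1 -> k <= 1) /\ (s = (s + t).-1 -> l <=
        1))%N.
  by lia.
suff main (a b : {mpoly int[n]}) : Q = a * b -> (msize a <= 1)%N \/ (msize b <=
    1)%N.
  move=> a b Qab; have [a1|b1] := main a b Qab; [left|right].
    exact: unitC Qab a1.
  by apply: unitC b1; rewrite Qab mulrC.
move=> Qab; have := Q0; rewrite Qab mulf_eq0 negb_or => /andP[a0 b0].
have [p [q [pq szp szq]]] : exists p q : {poly F},
    [/\ (map_mpoly intr Q).@[v] = p * q, (size p <= msize a)%N &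
        (size q <= msize b)%N].
  exists (map_mpoly intr a).@[v], (map_mpoly intr b).@[v]; split.
  - by rewrite Qab rmorphM /= mevalM.
  - exact: size_meval_linear a szv.
  - exact: size_meval_linear b szv.
have : p * q != 0 by rewrite -pq -size_poly_gt0 (leq_trans _ szQ).
rewrite mulf_eq0 negb_or => /andP[p0 q0].
have ms : ((msize a + msize b).-1 <= (size p + size q).-1)%N.
  by rewrite -(msizeM a0 b0) -(size_mul p0 q0) -Qab -pq.
have sp : (0 < size p)%N by rewrite size_poly_gt0.
have sq : (0 < size q)%N by rewrite size_poly_gt0.
have [left_unit right_unit] := arith _ _ _ _ sp sq szp szq ms.
have [p1|p1] := boolP (size p == 1%N); [left; exact: left_unit|right].
apply: right_unit; rewrite -(size_mul p0 q0); apply: eqp_size.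
by rewrite -pq; apply: irrQ; rewrite // pq dvdp_mulIl.
Qed.

(** * Coefficients of binary quadratic forms and Sylvester's resultant *)

(* The monomial x_0^a x_1^(2-a). *)
Definition quad_monomial (a : 'I_3) : 'X_{1..2} := 
  [multinom (if i == 0 :> nat then a : nat else 2 - a)%N | i < 2].

Lemma mdeg_quad_monomial a : mdeg (quad_monomial a) = 2%N.
Proof.
by rewrite mdegE !big_ord_recl big_ord0 !mnmE /= addn0 subnKC // -ltnS.
Qed.

Definition quad_index (a : 'I_3) : {mon : 'X_{1..2 < 3} | mdeg mon == 2} :=
  Sub (BMultinom (introT idP (etrans (congr1 (leq^~ 2) (mdeg_quad_monomial a))
      isT)
         : (mdeg (quad_monomial a) < 3)%N))
      (introT eqP (mdeg_quad_monomial a)).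

Definition quad_coef (i : 'I_2) (a : 'I_3) : 'I_#|coef_index 2 2| :=
  enum_rank ((i, quad_index a) : coef_index 2 2).

Lemma coef_vector_quad (K : comNzRingType) (f : 'I_2 -> {mpoly K[2]}) i a :
  coef_vector f (quad_coef i a) = (f i)@_(quad_monomial a).
Proof. by rewrite /coef_vector enum_rankK. Qed.

Lemma quad_form_eval (K : comNzRingType) (f : {mpoly K[2]}) (x : 'I_2 -> K) :
    f \is 2.-homog ->
  f.@[x] = \sum_(a < 3) f@_(quad_monomial a) * (x 0 ^+ a * x 1 ^+ (2 - a)).
Proof.
move=> homf.
have fE : f = \sum_(a < 3) f@_(quad_monomial a) *: 'X_[quad_monomial a].
  apply/mpolyP => m; rewrite raddf_sum /=.
  have [m2|m2] := eqVneq (mdeg m) 2%N; last first.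
    rewrite (dhomog_nemf_coeff homf m2) big1 // => a _.
    rewrite mcoeffZ mcoeffX; case: eqVneq => [am|_]; last by rewrite mulr0.
    by case/eqP: m2; rewrite -am mdeg_quad_monomial.
  have mE : (m 0%R + m 1%R = 2)%N 
    by apply: etrans m2; rewrite mdegE !big_ord_recl big_ord0 addn0;
        congr (_ + m _)%N; apply: val_inj.
  have m0 : (m 0%R < 3)%N by rewrite ltnS (leq_trans (leq_addr _ _) (eq_leq
      mE)).
  have -> : m = quad_monomial (Ordinal m0).
    apply/mnmP => i; rewrite mnmE; case: i => [[|[|//]] i2] /=.
      by congr (m _); apply: val_inj.
    apply: (@etrans _ _ (m 1%R)); first by congr (m _); apply: val_inj.
    exact: etrans (esym (addKn (m 0%R) (m 1%R))) (congr1 (subn^~ (m 0%R)) mE).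
  rewrite (bigD1 (Ordinal m0)) //= mcoeffZ mcoeffX eqxx mulr1 big1 ?addr0 // =>
      a am.
  rewrite mcoeffZ mcoeffX; case: eqVneq => [E|_]; last by rewrite mulr0.
  case/eqP: am; apply: val_inj; move/mnmP/(_ 0): E; rewrite !mnmE /=.
  by [].
rewrite {1}fE raddf_sum; apply: eq_bigr => a _ /=; rewrite mevalZ mevalX.
by rewrite !big_ord_recl big_ord0 !mnmE mulr1; congr (_ * (_ * x _ ^+ _));
    apply: val_inj.
Qed.

(** A quadratic monomial is determined by its exponent of x_0, which is at most 2, so [inord] loses
    nothing. *)
Definition quad_vector (K : Type) (g : 'I_2 -> 'I_3 -> K)
    (k : 'I_#|coef_index 2 2|) : K :=
  let u : coef_index 2 2 := enum_val k in g u.1 (inord (bmnm (val u.2) 0)).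

Lemma quad_vectorE (K : Type) (g : 'I_2 -> 'I_3 -> K) i a :
  quad_vector g (quad_coef i a) = g i a.
Proof.
rewrite /quad_vector enum_rankK /= mnmE /=; congr (g i _).
exact: inord_val.
Qed.

(** The subscript is the exponent of the first variable: the forms are a0 y^2 + a1 x y + a2 x^2 and
    likewise for b. The expression is u^2 - v w in the 2 by 2 minors of the coefficients. *)
Definition quad_res (K : comNzRingType) (a0 a1 a2 b0 b1 b2 : K) : K :=
  (a0 * b2 - a2 * b0) ^+ 2 - (a0 * b1 - a1 * b0) * (a1 * b2 - a2 * b1).

Definition quad_resultant : coef_poly 2 2 :=
  let X i a := 'X_(quad_coef i a) in
  quad_res (X 0 0) (X 0 1) (X 0 2) (X 1 0) (X 1 1) (X 1 2).

Lemma rmorph_quad_res (K L : comNzRingType) (phi : {rmorphism K -> L})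
    a0 a1 a2 b0 b1 b2 :
  phi (quad_res a0 a1 a2 b0 b1 b2) =
  quad_res (phi a0) (phi a1) (phi a2) (phi b0) (phi b1) (phi b2).
Proof. by rewrite /quad_res rmorphB rmorphXn rmorphB !rmorphM !rmorphB
    !rmorphM. Qed.

Lemma quad_resultant_eval (K : comNzRingType) (v : 'I_#|coef_index 2 2| -> K)
    (c := fun i a => v (quad_coef i a)) :
  (map_mpoly intr quad_resultant).@[v] =
  quad_res (c 0 0) (c 0 1) (c 0 2) (c 1 0) (c 1 1) (c 1 2).
Proof.
rewrite /quad_resultant (rmorph_quad_res (map_mpoly intr)) (rmorph_quad_res
    (meval v)).
have vX k : (map_mpoly intr 'X_k).@[v] = v k by rewrite map_mpolyX mevalXU.
by rewrite /c -!vX.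
Qed.

Lemma quad_resultant_homog : quad_resultant \is 4.-homog.
Proof.
have X2 i a j b : 'X_(quad_coef i a) * 'X_(quad_coef j b) \is 2.-homog :> bool.
  by apply: (@dhomogM _ _ _ 1 _ 1); rewrite dhomogX /= mdeg1.
apply: rpredB; first by apply: (@dhomogMn _ _ _ 2 _ 2); apply: rpredB;
    exact: X2.
by apply: (@dhomogM _ _ _ 2 _ 2); apply: rpredB; exact: X2.
Qed.

(** * Irreducibility of Sylvester's resultant *)

Lemma F2_cases (x : 'F_2) : x = 0 \/ x = 1.
Proof. by case: x => [[|[|]]] // i; [left|right]; apply: val_inj. Qed.

Lemma irreducible_F2_quartic : irreducible_poly ('X^4 + 'X + 1 : {poly 'F_2}).
Proof.
set P := _ + 1.
have PE : P = Poly [:: 1; 1; 0; 0; 1].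
  by rewrite /P /= !cons_poly_def; ring.
have szP : size P = 5%N by rewrite PE (@PolyK _ 0).
have noroot x : root P x = false.
  by rewrite /root /P !hornerE; case: (F2_cases x) => ->.
split=> [|p p1 pP]; first by rewrite szP.
have P0 : P != 0 by rewrite -size_poly_gt0 szP.
have [q Pq] := dvdpP _ _ pP.
have /andP[q0 p0] : (q != 0) && (p != 0) by rewrite -negb_or -mulf_eq0 -Pq.
have szpq : (size q + size p = 6)%N.
  have := szP; rewrite Pq size_mul //; rewrite -size_poly_gt0 in q0.
  by case: (size q) q0 => // s _ [<-].
(* A linear factor, whether [p] or its cofactor [q], would have a root. *)
have sp2 : size p <> 2%N.
  by move=> /poly2_root[x px]; have := noroot x; rewrite Pq rootM px orbT.
have sq2 : size q <> 2%N.
  by move=> /poly2_root[x px]; have := noroot x; rewrite Pq rootM px.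
(* Two quadratic factors over F_2 have constant and leading coefficients 1, so their product has the
   same coefficient p_1 + q_1 at X and at X^3, whereas the quartic has 1 and 0 there. *)
have sp3 : size p <> 3%N.
  move=> sp; have sq : size q = 3%N by move: szpq; rewrite sp addn3 => -[].
  have coefP k : \sum_(j < k.+1) q`_j * p`_(k - j) = [:: 1; 1; 0; 0; 1]`_k.
    by rewrite -coefM -Pq PE coef_Poly.
  have q3 k : q`_k.+3 = 0 by rewrite nth_default ?sq.
  have p3 k : p`_k.+3 = 0 by rewrite nth_default ?sp.
  have E0 : q`_0 * p`_0 + 0 = 1 by have := coefP 0%N;
      rewrite !big_ord_recl big_ord0.
  have E1 : q`_0 * p`_1 + (q`_1 * p`_0 + 0) = 1.
    by have := coefP 1%N; rewrite !big_ord_recl big_ord0.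
  have E3 : q`_0 * p`_3 + (q`_1 * p`_2 + (q`_2 * p`_1 + (q`_3 * p`_0 + 0))) = 0.
    by have := coefP 3%N; rewrite !big_ord_recl big_ord0.
  have E4 : q`_0 * p`_4 + (q`_1 * p`_3 + (q`_2 * p`_2 + (q`_3 * p`_1 + (q`_4 *
      p`_0 + 0)))) = 1.
    by have := coefP 4%N; rewrite !big_ord_recl big_ord0.
  move: E0 E1 E3 E4; rewrite !(q3, p3).
  move=> /eqP + /eqP + /eqP + /eqP.
  by case: (F2_cases q`_0) (F2_cases p`_0) (F2_cases q`_1) (F2_cases p`_1)
    (F2_cases q`_2) (F2_cases p`_2) => -> [] -> [] -> [] -> [] -> [] ->.
have szp : size p = 5%N.
  have arith (s t : nat) : (0 < s -> 0 < t -> t + s = 6 -> s != 1 -> s <> 2 ->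
    t <> 2 -> s <> 3 -> s = 5)%N by lia.
  by apply: (arith _ _ _ _ szpq p1 sp2 sq2 sp3); rewrite size_poly_gt0.
by rewrite -dvdp_size_eqp // szp szP.
Qed.

Lemma quad_resultant_irreducible : irreducible_elt quad_resultant.
Proof.
pose g i a : {poly 'F_2} :=
  nth 0 (nth [::] [:: [:: 'X; 0; 1]; [:: 1; 1;
      'X]] (val (i : 'I_2))) (val (a : 'I_3)).
(* The system (y^2, x^2), with a0 = b2 = 1 and all other coefficients 0, where the resultant is
   1. *)
pose c (i : 'I_2) (a : 'I_3) : int := (i + i == a)%N%:R.
have E : (map_mpoly intr quad_resultant).@[quad_vector g] = 'X^4 + 'X + 1.
  rewrite quad_resultant_eval !quad_vectorE /quad_res /g /=.
  have two0 : 2%:R = 0 :> {poly 'F_2} by rewrite -(rmorph_nat polyC) pchar_Fp_0.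
  have -> : ('X * 'X - 1 * 1) ^+ 2 - ('X * 1 - 0 * 1) * (0 * 'X - 1 * 1) =
    'X^4 + 'X + 1 - 2%:R * 'X^2 :> {poly 'F_2} by ring.
  by rewrite two0 mul0r subr0.
apply: (irreducible_of_linear_specialization (v := quad_vector g) (c :=
    quad_vector c)).
- move=> k; rewrite /quad_vector /g.
  case: (enum_val k).1 => [[|[|m]] // i1];
      case: (inord _) => [[|[|[|m]]] // a1];
    by rewrite /= ?size_polyX ?size_poly0 ?size_poly1.
- by rewrite E; exact: irreducible_F2_quartic.
- rewrite E; have -> : size ('X^4 + 'X + 1 : {poly 'F_2}) = 5%N.
    by rewrite -addrA size_polyDl size_polyXn // size_XaddC.
  have [->|Q0] := eqVneq quad_resultant 0; first by rewrite msize0.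
  by rewrite -mlead_deg // (dhomog_mf quad_resultant_homog) // mlead_supp.
- rewrite /quad_resultant (rmorph_quad_res (meval _)).
  have vX i a : ('X_(quad_coef i a)).@[quad_vector c] = c i a.
    by rewrite mevalXU quad_vectorE.
  transitivity (quad_res (c 0 0) (c 0 1) (c 0 2) (c 1 0) (c 1 1) (c 1 2));
      last by [].
  by congr quad_res; apply: vX.
Qed.

(** * Common zeros of two binary quadratic forms *)

(** At y = 1 the form is a polynomial of degree 2 in x, unless a2 = 0, and then (1, 0) is a zero. *)
Lemma quadratic_zero (F : closedFieldType) (a0 a1 a2 : F) :
  exists x y, ((x != 0) || (y != 0)) /\
    a0 * y ^+ 2 + a1 * (x * y) + a2 * x ^+ 2 = 0.
Proof.
have [->|a20] := eqVneq a2 0.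
  by exists 1, 0; rewrite oner_neq0; split=> //; ring.
have [|x] := @closed_rootP _ (Poly [:: a0; a1; a2]) _.
  by rewrite (@PolyK _ 0).
move/rootP; rewrite horner_Poly /= => rx.
by exists x, 1; rewrite oner_neq0 orbT; split=> //; rewrite -[RHS]rx; ring.
Qed.

Lemma quad_res_eq0 (F : closedFieldType) (a0 a1 a2 b0 b1 b2 : F) :
  quad_res a0 a1 a2 b0 b1 b2 = 0 <->
  exists x y, [/\ (x != 0) || (y != 0),
    a0 * y ^+ 2 + a1 * (x * y) + a2 * x ^+ 2 = 0 &
    b0 * y ^+ 2 + b1 * (x * y) + b2 * x ^+ 2 = 0].
Proof.
rewrite /quad_res; set u := a0 * b2 - _; set v := a0 * b1 - _;
    set w := a1 * b2 - _.
split=> [/eqP|[x [y [xy0 fxy gxy]]]]; last first.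
  have [x0|x0] := eqVneq x 0; last have [y0|y0] := eqVneq y 0.
  - have y0 : y ^+ 2 != 0 by rewrite expf_eq0 /=; move: xy0; rewrite x0 eqxx.
    have a00 : a0 = 0 by apply: (mulIf y0); rewrite mul0r -[RHS]fxy x0; ring.
    have b00 : b0 = 0 by apply: (mulIf y0); rewrite mul0r -[RHS]gxy x0; ring.
    by rewrite /u /v a00 b00; ring.
  - have x20 : x ^+ 2 != 0 by rewrite expf_eq0.
    have a20 : a2 = 0 by apply: (mulIf x20); rewrite mul0r -[RHS]fxy y0; ring.
    have b20 : b2 = 0 by apply: (mulIf x20); rewrite mul0r -[RHS]gxy y0; ring.
    by rewrite /u /w a20 b20; ring.
  have z0 : x * y ^+ 2 != 0 by rewrite mulf_neq0 // expf_eq0.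
  apply: (mulIf z0); rewrite mul0r.
  (* Write f and g for the forms. Eliminating x^2 gives b2 f - a2 g = y (u y + w x), eliminating y^2
     gives b0 f - a0 g = - x (v y + u x), and combining the two gives x y^2 (u^2 - v w). *)
  transitivity ((a0 * y ^+ 2 + a1 * (x * y) + a2 * x ^+ 2) * (u * x * b2 + w *
      y * b0)
      - (b0 * y ^+ 2 + b1 * (x * y) + b2 * x ^+ 2) * (u * x * a2 + w * y * a0)).
    by rewrite /u /v /w; ring.
  by rewrite fxy gxy !mul0r subr0.
rewrite subr_eq0 => /eqP uvw.
(* If [u^2 = v w], then both forms vanish at [(-v, u)] and at [(-u, w)]; when
   these points are zero, the forms are proportional. *)
have [|uv0] := boolP ((u != 0) || (v != 0)).
  exists (- v), u; rewrite oppr_eq0 orbC; split=> //.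
    transitivity (a0 * (u ^+ 2 - v * w)); first by rewrite /u /v /w; ring.
    by rewrite uvw subrr mulr0.
  transitivity (b0 * (u ^+ 2 - v * w)); first by rewrite /u /v /w; ring.
  by rewrite uvw subrr mulr0.
have [w0|w0] := eqVneq w 0; last first.
  exists (- u), w; rewrite w0 orbT; split=> //.
    transitivity (a2 * (u ^+ 2 - v * w)); first by rewrite /u /v /w; ring.
    by rewrite uvw subrr mulr0.
  transitivity (b2 * (u ^+ 2 - v * w)); first by rewrite /u /v /w; ring.
  by rewrite uvw subrr mulr0.
move: uv0; rewrite negb_or !negbK => /andP[/eqP u0 /eqP v0].
have [a_0|a_n0] := boolP [&& a0 == 0, a1 == 0 & a2 == 0].
  have [x [y [xy0 gxy]]] := quadratic_zero b0 b1 b2; exists x, y; split=> //.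
  by case/and3P: a_0 => /eqP-> /eqP-> /eqP->; rewrite !mul0r !addr0.
have [x [y [xy0 fxy]]] := quadratic_zero a0 a1 a2; exists x, y; split=> //.
(* As all minors vanish, each a_k g equals b_k times the first form, which is 0 at (x, y); if g were
   nonzero, every a_k would be 0. *)
set g := _ + _; apply/eqP; apply: contraNT a_n0 => g0.
apply/and3P; split; rewrite -(mulIr_eq0 _ (mulIf g0)); apply/eqP.
- transitivity (b0 * 0 + (v * (x * y) + u * x ^+ 2)).
    by rewrite -fxy /g /u /v; ring.
  by rewrite u0 v0; ring.
- transitivity (b1 * 0 + (w * x ^+ 2 - v * y ^+ 2)).
    by rewrite -fxy /g /w /v; ring.
  by rewrite w0 v0; ring.
- transitivity (b2 * 0 - (u * y ^+ 2 + w * (x * y))).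
    by rewrite -fxy /g /w /u; ring.
  by rewrite w0 u0; ring.
Qed.

Lemma quad_resultantP (R : realType) : is_resultant R quad_resultant.
Proof.
split; first exact: quad_resultant_irreducible; last first.
  (* At (x_0^2, x_1^2) only a2 = b0 = 1 are nonzero, so the formula gives (-1)^2 = 1. *)
  rewrite coef_evalE quad_resultant_eval !coef_vector_quad !mcoeffXn.
  have E (i : 'I_2) a :
      ((U_(i) *+ 2)%MM == quad_monomial a) = (a == (if i == 0 :> nat then 2
          else 0) :> nat)%N.
    apply/eqP/eqP => [/mnmP/(_ 0)|a2]; first rewrite mulmnE mnm1E mnmE /= => <-.
      by case: i => [[|[|]]].
    apply/mnmP => j; rewrite mulmnE mnm1E mnmE a2.
    by case: i j {a2} => [[|[|k]] i2] [[|[|l]] i3].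
  by rewrite !E /quad_res /=; ring.
move=> f homf; rewrite coef_evalE quad_resultant_eval !coef_vector_quad
    quad_res_eq0.
have fE i (x : 'I_2 -> R[i]) : (f i).@[x] =
    (f i)@_(quad_monomial 0) * x 1 ^+ 2 + (f i)@_(quad_monomial 1) * (x 0 * x 1)
    + (f i)@_(quad_monomial 2) * x 0 ^+ 2.
  rewrite (quad_form_eval _ (homf i)) !big_ord_recl big_ord0 /=.
  have -> : lift ord0 ord0 = 1 :> 'I_3 by apply: val_inj.
  have -> : lift ord0 (lift ord0 ord0) = 2 :> 'I_3 by apply: val_inj.
  by rewrite /bump /= !expr0 !expr1; ring.
split=> [[x [y [xy0 fxy gxy]]]|[x x0 fx]].
  exists (\col_i if i == 0 then x else y) => [|i].
    apply: contraTneq xy0 => /colP E; have := E 0; have := E 1; rewrite !mxE /=.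
    by move=> -> ->; rewrite eqxx.
  by rewrite fE !mxE /=; case: i => [[|[|]] // i2];
      [rewrite -[RHS]fxy|rewrite -[RHS]gxy];
    congr ((f _)@__ * _ + (f _)@__ * _ + (f _)@__ * _); apply: val_inj.
exists (x 0 0), (x 1 0); split; last first.
- by have := fx 1; rewrite fE.
- by have := fx 0; rewrite fE.
apply: contraNT x0; rewrite negb_or !negbK => /andP[/eqP x00 /eqP x10].
apply/eqP/colP => i; rewrite mxE; case: i => [[|[|]] // i2].
  by rewrite -[RHS]x00; congr (x _ _); apply: val_inj.
by rewrite -[RHS]x10; congr (x _ _); apply: val_inj.
Qed.

(** * The tensor and its rotation *)

Theorem proposition3p1 (R : realType) :
  exists (m n : nat) (A : tensor R[i] n m) (P : 'M[R[i]]_n),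
    [/\ (2 <= m)%N, (1 <= n)%N, eigenvalue_tensor A 0, orthogonal_mx P &
        alg_mult A 0 <> alg_mult (tensor_act P A) 0].
Proof.
have resE : exists Q : coef_poly 2 2, is_resultant R Q.
  by exists quad_resultant; exact: quad_resultantP.
pose c : R[i] := (sqrtC 2%:R)^-1.
have c0 : c != 0 by rewrite invr_eq0 sqrtC_eq0 pnatr_eq0.
have c2 : c * c *+ 2 = 1.
  rewrite -mulr_natr -invfM -expr2 sqrtCK mulVf // pnatr_eq0 //.
(* With indices starting at 0, the only nonzero entry of [A] is at (1, 0, 0), which yields the forms
   (0, x_0^2). *)
have [t0 t0E] : exists t : 3.-tuple 'I_2, val t = [:: 1; 0; 0].
  by exists [tuple 1; 0; 0].
pose A : tensor R[i] 2 3 := [ffun t => (t == t0)%:R].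
pose P : 'M[R[i]]_2 := \matrix_(i, j) (if (i == 1) && (j == 0) then - c else c).
have applyA (x : 'cV_2) i : tensor_apply A x i 0 = (i == 1)%:R * x 0 0 ^+ 2.
  rewrite mxE big_mkcond (bigD1 t0) //= [X in _ + X]big1 => [|t tA].
    rewrite t0E addr0 ffunE eqxx !big_cons big_nil mulr1 mul1r /= eq_sym.
    by rewrite -[Some i == _]/(i == 1); case: eqP; rewrite ?mul1r ?mul0r.
  by rewrite ffunE (negbTE tA) mul0r if_same.
(* [A] is a tensor product of basis vectors, so the rotated tensor is the product of the
   corresponding columns of [P]. *)
have actA i a b : tensor_act P A [tuple i; a; b] = P i 1 * P a 0 * P b 0.
  rewrite ffunE (bigD1 t0) //= [X in _ + X]big1 => [|t tA].
    by rewrite addr0 ffunE eqxx mul1r !big_ord_recl big_ord0 mulr1 mulrA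
        !(tnth_nth 0) t0E.
  by rewrite ffunE (negbTE tA) mul0r.
have apply_actA (x : 'cV_2) i : tensor_apply (tensor_act P A) x i 0 =
    P i 1 * (\sum_a P a 0 * x a 0) ^+ 2.
  rewrite mxE (reindex_onto (fun u : 'I_2 * 'I_2 => [tuple i; u.1; u.2])
    (fun t => (tnth t 1, tnth t 2))) /=; last first.
    case/tupleP => i0 t; case/tupleP: t => a t; case/tupleP: t => b t.
    by rewrite tuple0 => /eqP[->]; apply: val_inj.
  rewrite expr2 mulr_suml mulr_sumr.
  transitivity (\sum_a \sum_b tensor_act P A [tuple i; a; b] * (x a 0 * x b 0)).
    rewrite pair_bigA; apply: eq_big => [[a b]|[a b] _] /=;
        first by apply/andP; split; apply/eqP.
    by rewrite !big_cons big_nil mulr1.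
  apply: eq_bigr => a _; rewrite !mulr_sumr; apply: eq_bigr => b _.
  by rewrite actA; ring.
exists 3%N, 2%N, A, P; split; [by []|by []| | |].
(* The forms involve x_0 only, so they vanish at (0, 1). *)
- exists (\col_i (i == 1)%:R).
    by apply/eqP => /colP/(_ 1)/eqP; rewrite !mxE oner_eq0.
  by apply/colP => i; rewrite applyA !mxE /= expr0n !mulr0 mul0r.
- apply/matrixP => i j; rewrite !mxE !big_ord_recl big_ord0 !mxE /=.
  case: i j => [[|[|]]] // i2 [[|[|]]] // j2;
    by rewrite /= ?mulrN ?mulNr ?opprK addr0 ?subrr ?addNr -?mulr2n ?c2.
rewrite alg_mult_nilpotent //; last first.
  (* For an eigenvalue [x] other than 0, the first equation gives y_0 = 0, and then the second gives
     y_1 = 0. *)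
  move=> x [y y0 /colP yx]; apply: contraNeq y0 => x0.
  have {}yx i : (i == 1)%:R * y 0 0 ^+ 2 = x * y i 0 ^+ 2
      by rewrite -applyA yx mxE.
  have y00 : y 0 0 = 0.
    by have /eqP := yx 0; rewrite mul0r eq_sym mulf_eq0 (negbTE x0) expf_eq0 /=
        => /eqP.
  apply/eqP/colP => i; rewrite mxE; have /eqP := yx i.
  by rewrite y00 expr0n mulr0 eq_sym mulf_eq0 (negbTE x0) expf_eq0 /= => /eqP.
apply/eqP; rewrite gtn_eqF //.
(* At (1, -1) the pairing with the first column (c, -c) of [P] is 2c. Both entries of the rotated
   system are thus c (2c)^2 = 2c, since 2 c^2 = 1, while both squared coordinates are 1; the
   eigenvalue is 2c. *)
apply: (alg_mult_eigenvalue resE (x := 2%:R * c));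
    first by rewrite mulf_neq0 // pnatr_eq0.
exists (\col_i (-1) ^+ i).
  by apply/eqP => /colP/(_ 0)/eqP; rewrite !mxE oner_eq0.
apply/colP => i; rewrite apply_actA !mxE !big_ord_recl big_ord0 !mxE andbF.
have -> : ((-1) ^+ i) ^+ 2 = 1 :> R[i]
    by rewrite -exprM mulnC exprM sqrrN !expr1n.
rewrite /= expr0 expr1 mulr1 mulrNN mulr1 addr0 mulr1.
by transitivity (2%:R * c * (c * c *+ 2)); [ring|rewrite c2 mulr1].
Qed.
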